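(* Let $\Omega$ be a bounded domain in $\mathbb{R}^n$, $p\geq 1$, let $f$ satisfy the standing assumptions with $k=(f')^{-1}$, and let $\nu=\sum_{i=1}^m a_i\delta_{x_i}\in\mathcal{P}(\Omega)$ be a purely atomic probability with finitely many atoms $x_1,\dots,x_m$. If $\mu=u\cdot\mathcal{L}^n$ minimizes $\mathfrak{F}^p_\nu$ over $\mathcal{P}(\Omega)$, then there exist constants $c_1,\dots,c_m\in\mathbb{R}$ such that $$u(x)=k\Big(\max\big\{c_1-|x-x_1|^p,\dots,c_m-|x-x_m|^p,0\big\}\Big)\quad\text{for a.e. }x\in\Omega.$$ In particular, up to a Lebesgue-null set, $\{u>0\}=\Omega\cap\bigcup_{i:\,c_i>0}B(x_i,c_i^{1/p})$.
   Context: A bounded domain is a bounded set $\Omega\subset\mathbb{R}^n$ which is the closure of a nonempty connected open set and whose boundary is Lebesgue-negligible. $\mathcal{P}(\Omega)$ is the set of Borel probability measures on $\Omega$. Standing assumptions on $f$: $f:[0,+\infty)\to[0,+\infty)$ is strictly convex and $C^1$, $f(0)=0$, $f'(0)=0$, and $\lim_{t\to+\infty}f(t)/t=+\infty$; $k=(f')^{-1}:[0,+\infty)\to[0,+\infty)$, continuous and strictly increasing with $k(0)=0$. $T_p(\mu,\nu)=\inf_\gamma\int|x-y|^p\,d\gamma$ over transport plans. $F(\mu)=\int_\Omega f(u)\,dx$ if $\mu=u\cdot\mathcal{L}^n$, $+\infty$ otherwise. $\mathfrak{F}^p_\nu(\mu)=T_p(\mu,\nu)+F(\mu)$. $B(x,r)$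 is the open ball of center $x$ and radius $r$. *)

(* Defs.v *)
(* R^n is modelled as [n.-tuple R]
   with its canonical product (= Borel) sigma-algebra. *)
From HB Require Import structures.
From mathcomp Require Import all_boot all_order all_algebra.
From mathcomp Require Import all_classical all_reals all_analysis.
Set Implicit Arguments. Unset Strict Implicit. Unset Printing Implicit Defensive.
Import Order.TTheory GRing.Theory Num.Theory.
Import numFieldNormedType.Exports.
Local Open Scope classical_set_scope.
Local Open Scope ring_scope.

Section Defs.
Variables (R : realType) (n : nat).
Local Notation V := (n.-tuple R).

Definition eudist (x y : V) : R :=
  Num.sqrt (\sum_(i < n) (tnth x i - tnth y i) ^+ 2).

Definition eball (x : V) (r : R) : set V := [set y | eudist x y < r].

Definition eopen (A : set V) : Prop :=
  forall x, A x -> exists r, 0 < r /\ eball x r `<=` A.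

Definition eclosure (A : set V) : set V :=
  [set x | forall r, 0 < r -> exists y, A y /\ eudist x y < r].

Definition einterior (A : set V) : set V :=
  [set x | exists r, 0 < r /\ eball x r `<=` A].

Definition eboundary (A : set V) : set V := eclosure A `\` einterior A.

Definition econnected (A : set V) : Prop :=
  forall U W, eopen U -> eopen W -> A `<=` U `|` W -> A `&` U `&` W = set0 ->
    A `&` U = set0 \/ A `&` W = set0.

Definition ebounded (A : set V) : Prop :=
  exists M : R, forall x y, A x -> A y -> eudist x y <= M.

Definition ebox (a b : V) : set V :=
  [set x | forall i, tnth a i <= tnth x i /\ tnth x i < tnth b i].

(* [lam] is the Lebesgue measure on the Borel sets of R^n: the (unique)
   measure giving every box its volume. *)
Definition is_lebesgue (lam : {measure set V -> \bar R}) : Prop :=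
  forall a b : V, (forall i, tnth a i <= tnth b i) ->
    lam (ebox a b) = (\prod_(i < n) (tnth b i - tnth a i))%:E.

Definition bounded_domain (lam : {measure set V -> \bar R}) (Omega : set V) : Prop :=
  ebounded Omega /\
  (exists G, eopen G /\ G !=set0 /\ econnected G /\ Omega = eclosure G) /\
  lam.-negligible (eboundary Omega).

Definition Prob (Omega : set V) : set (probability V R) :=
  [set mu | mu (~` Omega) = 0%E].

Definition is_density (lam : {measure set V -> \bar R}) (mu : probability V R)
    (u : V -> R) : Prop :=
  measurable_fun setT u /\ (forall x, 0 <= u x) /\
  forall A, measurable A -> mu A = (\int[lam]_(x in A) (u x)%:E)%E.

Definition is_plan (mu nu : probability V R) (g : probability (V * V)%type R) : Prop :=
  forall A, measurable A -> g (A `*` setT) = mu A /\ g (setT `*` A) = nu A.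

Definition Tcost (p : R) (mu nu : probability V R) : \bar R :=
  ereal_inf [set (\int[g]_z (powR (eudist z.1 z.2) p)%:E)%E | g in is_plan mu nu].

Definition Fen (lam : {measure set V -> \bar R}) (f : R -> R) (Omega : set V)
    (mu : probability V R) : \bar R :=
  ereal_inf [set (\int[lam]_(x in Omega) (f (u x))%:E)%E | u in is_density lam mu].

Definition Ffrak (lam : {measure set V -> \bar R}) (f : R -> R) (Omega : set V)
    (p : R) (nu mu : probability V R) : \bar R :=
  (Tcost p mu nu + Fen lam f Omega mu)%E.

End Defs.

(* Main.v *)
Require Import Defs.
From HB Require Import structures.
From mathcomp Require Import all_boot all_order all_algebra.
From mathcomp Require Import all_classical all_reals all_analysis measurable_realfun.
From mathcomp Require Import ring lra zify.
Set Implicit Arguments. Unset Strict Implicit. Unset Printing Implicit Defensive.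
Import Order.TTheory GRing.Theory Num.Theory.
Import numFieldNormedType.Exports.
Local Open Scope classical_set_scope.
Local Open Scope ring_scope.

(* Put [g_i x = f'(u x) + |x - x_i|^p] and let [c_i] be the essential infimum of [g_i] on [Omega].

   Upper bound. Fix [e > 0] and move a fraction [t] of the mass attached to each atom [x_i] uniformly
   onto the set [B_i] where [g_i < c_i + e]. The transport cost is convex along this mixture, so
   minimality of [mu] and the tangent inequality for [f] at the mixed density give, as [t -> 0]
   (Fatou on the side of [u], dominated convergence on the side of the competitor, whose support lies
   where [u] is bounded), [T_p(mu, nu) + int f'(u) dmu <= sum_i a_i (c_i + e)]; then let [e -> 0].

   Lower bound. Let [M = max (0, max_i (c_i - |x - x_i|^p))]. By the choice of [c_i], [f'(u) >= M] a.e.,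
   and [f'(u x) + |x - x_i|^p >= c_i + (f'(u x) - M x)]. Integrating against any plan and taking the
   infimum yields [T_p(mu, nu) + int f'(u) dmu >= sum_i a_i c_i + int (f'(u) - M) dmu].

   Hence [f'(u) = M] wherever [u > 0], while [0 <= M <= f'(0) = 0] wherever [u = 0]. No optimal plan,
   no Kantorovich potential and no decomposition of [mu] along the atoms is needed. *)

(** * Tangent lines of [f], monotonicity of [f] and [df], and the inverse [k] *)

Section convex_function.
Variables (R : realType) (f df k : R -> R).
Hypothesis fge0 : forall t : R, 0 <= t -> 0 <= f t.
Hypothesis fconvex : forall x y l : R, 0 <= x -> 0 <= y -> x != y -> 0 < l < 1 ->
     f (l * x + (1 - l) * y) < l * f x + (1 - l) * f y.
Hypothesis fdf : forall t : R, 0 < t -> is_derive t 1 f (df t).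
Hypothesis f0 : f 0 = 0.
Hypothesis df0 : df 0 = 0.
Hypothesis dfK : forall t : R, 0 <= t -> k (df t) = t.
Hypothesis kK : forall s : R, 0 <= s -> 0 <= k s /\ df (k s) = s.

Lemma convex_le (x y l : R) : 0 <= x -> 0 <= y -> 0 < l < 1 ->
  f (l * x + (1 - l) * y) <= l * f x + (1 - l) * f y.
Proof.
move=> x0 y0 l01; have [<-|xy] := eqVneq x y; last exact/ltW/fconvex.
by rewrite -!mulrDl addrC subrK !mul1r.
Qed.

(** By convexity the slope of [phi l = f (t + l * (s - t))] over [[0, h]] is at most [f s - f t];
    letting [h] decrease to 0 turns this slope into [df t * (s - t)]. At [t = 0], where [fdf] says
    nothing, [f0] and [df0] reduce the claim to [0 <= f s]. *)
Lemma tangent_le (s t : R) : 0 <= s -> 0 <= t -> f t + df t * (s - t) <= f s.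
Proof.
move=> s0; rewrite le_eqVlt => /predU1P[<-|t0].
  by rewrite f0 df0 mul0r addr0 fge0.
rewrite -lerBrDl.
pose phi (l : R) := f (t + l * (s - t)).
have dphi : is_derive (0 : R) (1 : R) phi (df t * (s - t)).
  apply: (@is_derive1_comp _ f (fun l => t + l * (s - t)) 0 (df t) (s - t)).
    by rewrite mul0r addr0; exact: fdf.
  apply: is_derive_eq.
  by rewrite /GRing.scale /=; ring.
have cphi : h^-1 * (phi h - phi 0) @[h --> 0^'+] --> df t * (s - t).
  apply: cvg_dnbhs_at_right; have [dv <-] := dphi.
  rewrite (_ : (fun h : R => h^-1 * (phi h - phi 0)) =
    (fun h : R => h^-1 *: ((phi \o shift 0) (h *: 1) - phi 0))) //.
  by apply/funext => h; rewrite /= addr0 /GRing.scale /= mulr1.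
rewrite -(cvg_lim _ cphi) //; apply: limr_le; first by apply: cvgP cphi.
near=> h.
have h0 : 0 < h by near: h; exact: nbhs_right_gt.
have h1 : h < 1 by near: h; exact: nbhs_right_lt.
rewrite /phi mul0r addr0 mulrC ler_pdivrMr //.
have h01 : 0 < h < 1 by rewrite h0 h1.
have := @convex_le s t h s0 (ltW t0) h01.
by rewrite (_ : h * s + (1 - h) * t = t + h * (s - t)); [lra|ring].
Unshelve. all: by end_near. Qed.

(** Adding the tangent inequalities at [s] and at [t] gives [(df t - df s) * (t - s) >= 0]. *)
Lemma df_nondecreasing (s t : R) : 0 <= s -> s <= t -> df s <= df t.
Proof.
move=> s0; rewrite le_eqVlt => /predU1P[->//|st].
have t0 : 0 <= t by lra.
have := tangent_le s0 t0; have := tangent_le t0 s0.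
nra.
Qed.

Lemma df_ge0 (t : R) : 0 <= t -> 0 <= df t.
Proof. by move=> t0; rewrite -df0; exact: df_nondecreasing. Qed.

Lemma convex_nondecreasing (s t : R) : 0 <= s -> s <= t -> f s <= f t.
Proof.
move=> s0 st; have t0 : 0 <= t by lra.
have := tangent_le t0 s0; have := df_ge0 s0; nra.
Qed.

(** If [k s <= t], monotonicity gives [s = df (k s) <= df t]. This turns a bound on [df (u x)] into
    a bound on [u x], as the domination argument requires. *)
Lemma lt_inverse_derivative (s t : R) : 0 <= s -> 0 <= t -> df t < s -> t < k s.
Proof.
move=> s0 t0; have [ks0 ksE] := kK s0; rewrite ltNge -{1}ksE; apply: contraNlt.
exact: df_nondecreasing.
Qed.

Lemma inverse_derivative0 : k 0 = 0.
Proof. by rewrite -[X in k X]df0 dfK. Qed.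

Lemma inverse_derivative_gt0 (s : R) : 0 <= s -> (0 < k s) = (0 < s).
Proof.
move=> s0; have [ks0 ksE] := kK s0.
rewrite !lt_def ks0 s0 !andbT; congr (~~ _); apply/eqP/eqP => [h|->]; last exact: inverse_derivative0.
by rewrite -ksE h df0.
Qed.

(** [h] is monotone only on the half-line; precomposing it with [max 0] makes it monotone on all of
    [R] and does not change [h \o v]. *)
Lemma measurable_ge0_nondecreasing (d : measure_display) (T : measurableType d)
    (h : R -> R) (v : T -> R) :
  {in `[0, +oo[ &, {homo h : x y / x <= y}} ->
  measurable_fun setT v -> (forall x, 0 <= v x) -> measurable_fun setT (h \o v).
Proof.
move=> hh mv v0.
have -> : h \o v = (fun t => h (Num.max 0 t)) \o v.
  by apply/funext => x /=; rewrite max_r.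
apply: (measurableT_comp _ mv); apply: nondecreasing_measurable => // x y xy.
have m0 (z : R) : Num.max 0 z \in `[0, +oo[ by rewrite in_itv/= andbT le_max lexx.
by apply: hh; rewrite ?m0// ge_max !le_max lexx xy orbT.
Qed.

End convex_function.

(** * Euclidean distance, boxes and closures: measurability and finite volume *)

Section euclidean.
Variables (R : realType) (n : nat).
Local Notation V := (n.-tuple R).
Implicit Types (x y z : V) (G : set V).

Lemma eudist_ge0 x y : 0 <= eudist x y.
Proof. exact: sqrtr_ge0. Qed.

Lemma le_coord_eudist x y i : `|tnth x i - tnth y i| <= eudist x y.
Proof.
rewrite /eudist -sqrtr_sqr ler_wsqrtr // (bigD1 i) //= lerDl.
by apply: sumr_ge0 => j _; exact: sqr_ge0.
Qed.

(** The [n] squares sum to at most [n / (n + 1) ^ 2 * r ^ 2]; dividing by [n + 1] keeps the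
    inequality strict and covers [n = 0]. *)
Lemma eudist_lt x y (r : R) : 0 < r ->
  (forall i, `|tnth x i - tnth y i| <= r / n.+1%:R) -> eudist x y < r.
Proof.
move=> r0 h; rewrite /eudist -[ltRHS]ger0_norm ?(ltW r0)// -sqrtr_sqr ltr_sqrt ?exprn_gt0//.
apply: (@le_lt_trans _ _ (\sum_(i < n) (r / n.+1%:R) ^+ 2)).
  apply: ler_sum => i _; rewrite -real_normK ?num_real// ler_sqr ?nnegrE ?h//.
  by rewrite divr_ge0 ?(ltW r0).
rewrite sumr_const card_ord expr_div_n -mulrnAr -mulr_natr.
rewrite -[ltRHS]mulr1 ltr_pM2l ?exprn_gt0// mulrC ltr_pdivrMr ?exprn_gt0//.
rewrite mul1r -natrX ltr_nat; lia.
Qed.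

Lemma eudist_eq0 x y : eudist x y = 0 -> x = y.
Proof.
move=> xy; apply: eq_from_tnth => i; apply/eqP; rewrite -subr_eq0 -normr_le0 -xy.
exact: le_coord_eudist.
Qed.

Lemma eudist0 x : eudist x x = 0.
Proof. by rewrite /eudist big1 ?sqrtr0// => i _; rewrite subrr expr0n. Qed.

Lemma measurable_eudist :
  measurable_fun [set: V * V] (fun z : V * V => eudist z.1 z.2).
Proof.
apply: (@measurableT_comp _ _ _ _ _ _ (@Num.sqrt R)).
  by apply: nondecreasing_measurable => // a b ab; exact: ler_wsqrtr.
apply: measurable_sum => i; apply: measurable_funX; apply: measurable_funB.
- by apply: measurableT_comp (measurable_tnth i) _; exact: measurable_fst.
- by apply: measurableT_comp (measurable_tnth i) _; exact: measurable_snd.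
Qed.

Lemma measurable_eudist_powR (p : R) :
  measurable_fun [set: V * V] (fun z : V * V => powR (eudist z.1 z.2) p).
Proof. exact: measurableT_comp (measurable_powR p) measurable_eudist. Qed.

Lemma measurable_eudist_powRl (p : R) y :
  measurable_fun [set: V] (fun x => powR (eudist x y) p).
Proof.
apply: (measurableT_comp (measurable_eudist_powR p) (_ : measurable_fun _ (fun x => (x, y)))).
by apply: measurable_fun_pair => //; exact: measurable_cst.
Qed.

Lemma measurable_esing y : measurable [set y].
Proof.
have -> : [set y] = [set x | eudist x y <= 0].
  apply/seteqP; split => x /= => [->|h]; first by rewrite eudist0.
  by apply: eudist_eq0; apply/le_anti; rewrite h eudist_ge0.
have m : measurable_fun [set: V] (fun x => eudist x y).
  apply: (measurableT_comp measurable_eudist (_ : measurable_fun _ (fun x => (x, y)))).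
  by apply: measurable_fun_pair => //; exact: measurable_cst.
have := m measurableT _ (measurable_itv `]-oo, (0 : R)]); rewrite setTI.
by congr measurable; apply/seteqP; split => x /=; rewrite in_itv.
Qed.

Lemma measurable_coord_itv (I : 'I_n -> interval R) :
  measurable [set x : V | forall i, tnth x i \in I i].
Proof.
have -> : [set x : V | forall i, tnth x i \in I i] =
    \big[setI/setT]_(i < n) ((fun x : V => tnth x i) @^-1` [set` I i]).
  rewrite -bigcap_seq; apply/seteqP; split => x /= h i; first by move=> _; exact: h.
  by apply: (h i); rewrite /= mem_index_enum.
apply: bigsetI_measurable => i _; rewrite -[X in measurable X]setTI.
by apply: measurable_tnth => //; exact: measurable_itv.
Qed.

Lemma measurable_ebox x y : measurable (ebox x y).
Proof.
have := measurable_coord_itv (fun i => `[tnth x i, tnth y i[).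
congr measurable; apply/seteqP; split => z /= h i; have := h i; rewrite in_itv /=.
  by move/andP.
by case=> -> ->.
Qed.

Lemma ebounded_measure_lty (lam : {measure set V -> \bar R}) (A : set V) :
  is_lebesgue lam -> measurable A -> ebounded A -> (lam A < +oo)%E.
Proof.
move=> hlam mA [M hM].
have [->|/set0P[x0 Ax0]] := eqVneq A set0; first by rewrite measure0.
have M0 : 0 <= M by apply: le_trans (hM _ _ Ax0 Ax0); exact: eudist_ge0.
(* Each coordinate on [A] is within [M] of that of [x0]; the extra 1 is there because boxes exclude
   their upper faces. *)
pose l : V := [tuple tnth x0 i - M | i < n]; pose h : V := [tuple tnth x0 i + M + 1 | i < n].
apply: (@le_lt_trans _ _ (lam (ebox l h))); last first.
  by rewrite hlam ?ltry// => i; rewrite !tnth_mktuple; lra.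
apply: le_measure; rewrite ?inE//; first exact: measurable_ebox.
move=> x Ax i; rewrite !tnth_mktuple.
have := le_trans (le_coord_eudist x x0 i) (hM _ _ Ax Ax0).
rewrite ler_norml => /andP[]; split; lra.
Qed.

(* The complement of the closure is the union of the open boxes with rational corners missing [G]. *)
Lemma measurable_eclosure G : measurable (eclosure G).
Proof.
pose Q (q : (n.-tuple rat) * (n.-tuple rat)) : set V :=
  [set x | forall i, tnth x i \in `](ratr (tnth q.1 i) : R), ratr (tnth q.2 i)[].
pose F q := if pselect (Q q `&` G = set0) then Q q else set0.
have -> : eclosure G = ~` \bigcup_q F q.
  rewrite -[LHS]setCK; congr (~` _); apply/seteqP; split => x.
  - move=> /existsNP[r /not_implyP[r0 /forallNP hr]].
    pose e : R := r / n.+1%:R; have e0 : 0 < e by rewrite divr_gt0.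
    have ex1 (i : 'I_n) : exists q : rat,
        (ratr q : R) \in `]tnth x i - e, tnth x i[.
      by apply: rat_in_itvoo; lra.
    have ex2 (i : 'I_n) : exists q : rat,
        (ratr q : R) \in `]tnth x i, tnth x i + e[.
      by apply: rat_in_itvoo; lra.
    have [q1 hq1] := fin_all_exists ex1; have [q2 hq2] := fin_all_exists ex2.
    pose q := ([tuple q1 i | i < n], [tuple q2 i | i < n]).
    have Qx : Q q x.
      move=> i /=; rewrite !tnth_mktuple in_itv/=.
      by have := hq1 i; have := hq2 i; rewrite !in_itv/= => /andP[-> _] /andP[_ ->].
    exists q => //; rewrite /F; case: pselect => // -[].
    rewrite -subset0 => y [Qy Gy]; apply: (hr y); split => //.
    apply: eudist_lt => // i; have := Qy i; rewrite /= !tnth_mktuple.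
    have := hq1 i; have := hq2 i; rewrite !in_itv/= ler_norml -/e.
    by move=> /andP[? ?] /andP[? ?] /andP[? ?]; apply/andP; split; lra.
  - move=> [q _]; rewrite /F; case: pselect => // QG Qx clx.
    pose r : R := \big[Num.min/1]_(i < n)
      Num.min (tnth x i - ratr (tnth q.1 i)) (ratr (tnth q.2 i) - tnth x i).
    have r0 : 0 < r.
      rewrite /r; elim/big_ind : _ => // [a b a0 b0|i _]; rewrite lt_min ?a0//.
      by have := Qx i; rewrite in_itv/= !subr_gt0.
    have [y [Gy xy]] := clx _ r0.
    suff : (Q q `&` G) y by rewrite QG.
    split => // i; have := le_coord_eudist x y i.
    have ri : r <= Num.min (tnth x i - ratr (tnth q.1 i)) (ratr (tnth q.2 i) - tnth x i).
      exact: bigmin_le.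
    move: ri; rewrite le_min => /andP[? ?]; rewrite ler_norml => /andP[? ?].
    by rewrite in_itv/=; apply/andP; split; lra.
apply: measurableC; apply: countable_bigcupT_measurable => [|q].
  exact: countableP.
by rewrite /F; case: pselect => h /=; [exact: measurable_coord_itv|exact: measurable0].
Qed.

End euclidean.

(** * Densities, essential infima and the construction of measures *)

Section measure_facts.
Context (d : measure_display) (T : measurableType d) (R : realType).
Local Open Scope ereal_scope.

Import HBNNSimple.

(** The identity is [hm] on indicators, extends by linearity to simple functions, and passes to [h]
    by monotone convergence along [g n]. *)
Lemma ge0_integral_density (mu m : {measure set T -> \bar R}) (u : T -> R) (h : T -> \bar R) :
  measurable_fun setT u -> (forall x, (0 <= u x)%R) ->
  (forall A, measurable A -> m A = \int[mu]_(x in A) (u x)%:E) ->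
  measurable_fun setT h -> (forall x, 0 <= h x) ->
  \int[m]_x h x = \int[mu]_x (h x * (u x)%:E).
Proof.
move=> mu_ u0 hm mh h0.
have mEu : measurable_fun setT (EFin \o u) by exact/measurable_EFinP.
pose g := nnsfun_approx measurableT mh.
have -> : \int[m]_x h x = limn (fun n => \int[m]_x (EFin \o g n) x).
  rewrite -monotone_convergence//.
  - by apply: eq_integral => x _; apply/esym/cvg_lim => //; exact: cvg_nnsfun_approx.
  - by move=> n; exact/measurable_EFinP.
  - by move=> n x _; rewrite lee_fin.
  - by move=> x _ a b ab; rewrite lee_fin; exact/lefP/nd_nnsfun_approx.
have -> : \int[mu]_x (h x * (u x)%:E) = limn (fun n => \int[mu]_x ((g n x)%:E * (u x)%:E)).
  rewrite -monotone_convergence//.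
  - apply: eq_integral => x _; apply/esym/cvg_lim => //.
    by apply: cvgeZr => //; exact: cvg_nnsfun_approx.
  - by move=> n; apply: emeasurable_funM => //; exact/measurable_EFinP.
  - by move=> n x _; rewrite mule_ge0// lee_fin.
  - move=> x _ a b ab; rewrite lee_wpmul2r ?lee_fin//; exact/lefP/nd_nnsfun_approx.
congr (limn _); apply/funext => n.
transitivity (\int[m]_x (\sum_(y \in range (g n)) (y * \1_(g n @^-1` [set y]) x)%:E)).
  by apply: eq_integral => t _; rewrite /= fimfunE -fsumEFin.
have mind r : measurable_fun setT (fun x => (r * \1_(g n @^-1` [set r]) x)%:E).
  by apply/measurable_EFinP; exact: measurable_funM.
rewrite ge0_integral_fsum//; last by move=> y x _; exact: nnfun_muleindic_ge0.
transitivity (\int[mu]_x (\sum_(y \in range (g n))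
    (y * \1_(g n @^-1` [set y]) x)%:E * (u x)%:E)); last first.
  apply: eq_integral => x _.
  rewrite -ge0_mule_fsuml => [|y]; last exact: nnfun_muleindic_ge0.
  by rewrite fsumEFin // -(fimfunE _ x).
rewrite ge0_integral_fsum//; last 2 first.
  - by move=> y; exact: emeasurable_funM.
  - by move=> y x _; apply: mule_ge0; [exact: nnfun_muleindic_ge0|rewrite lee_fin].
apply: eq_fsbigr => r; rewrite inE => -[y _ yr].
have r0 : (0 <= r)%R by rewrite -yr.
have mr : measurable (g n @^-1` [set r]) by [].
under eq_integral do rewrite EFinM.
rewrite ge0_integralZl_EFin//; last by apply/measurable_EFinP.
rewrite integral_indic// setIT hm//.
under [RHS]eq_integral do rewrite EFinM -muleA.
rewrite ge0_integralZl_EFin//; first last.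
  - by apply: emeasurable_funM => //; exact/measurable_EFinP.
  - by move=> x _; rewrite mule_ge0// lee_fin.
congr (_ * _); rewrite integral_mkcond; apply: eq_integral => x _.
by rewrite epatch_indic muleC.
Qed.

(** [c] is the supremum of the levels whose sublevel set in [D] is null. These levels are bounded
    because [D], of positive measure, is the union of its sublevel sets at integer levels. The
    supremum is itself such a level, since [g x < sup S] forces [g x < sup S - 1 / (k + 1)] for some
    [k]. *)
Lemma exists_ess_inf (mu : {measure set T -> \bar R}) (D : set T) (g : T -> R) :
  measurable D -> 0 < mu D -> measurable_fun setT g -> (forall x, (0 <= g x)%R) ->
  exists c : R, [/\ (0 <= c)%R, mu (D `&` [set x | (g x < c)%R]) = 0 &
    forall e : R, (0 < e)%R -> 0 < mu (D `&` [set x | (g x < c + e)%R])].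
Proof.
move=> mD D0 mg g0.
have mS c : measurable (D `&` [set x | (g x < c)%R]).
  apply: measurableI => //; rewrite -[X in measurable X]setTI.
  have := mg measurableT _ (measurable_itv `]-oo, c[).
  by congr measurable; apply/seteqP; split => x /=; rewrite in_itv.
have mono a b : (a <= b)%R -> mu (D `&` [set x | (g x < b)%R]) = 0 ->
    mu (D `&` [set x | (g x < a)%R]) = 0.
  move=> ab h; apply/eqP; rewrite eq_le measure_ge0 andbT -h.
  by apply: le_measure; rewrite ?inE// => x [Dx] /= gx; split => //=; exact: lt_le_trans ab.
pose S := [set c : R | mu (D `&` [set x | (g x < c)%R]) = 0].
have S0 : S 0%R.
  rewrite /S /= (_ : _ `&` _ = set0) ?measure0//.
  by rewrite -subset0 => x [_] /=; rewrite ltNge g0.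
have [N SN] : exists N : nat, ~ S N%:R%R.
  apply/existsNP => SN; move: D0; rewrite lt_neqAle => /andP[/eqP + _]; apply.
  apply/esym/negligibleP => //.
  apply: (@negligibleS _ _ _ _ (\bigcup_k (D `&` [set x | (g x < k%:R)%R]))).
    move=> x Dx; exists (Num.truncn (g x)).+1 => //; split => //=.
    exact: truncnS_gt.
  by apply: negligible_bigcup => k; apply/negligibleP => //; exact: SN.
have Sub : ubound S N%:R%R.
  move=> c Sc; rewrite leNgt; apply/negP => Nc; apply: SN; apply: mono Sc; exact: ltW.
have Ssup : has_sup S by split; [exists 0%R|exists N%:R%R].
exists (sup S); split.
- by apply: ub_le_sup => //; case: Ssup.
- apply/negligibleP => //.
  apply: (@negligibleS _ _ _ _ (\bigcup_k (D `&` [set x | (g x < sup S - k.+1%:R^-1)%R]))).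
    move=> x [Dx /= gx].
    have [k hk] := ltr_add_invr gx.
    by exists k => //; split => //=; rewrite ltrBrDr.
  apply: negligible_bigcup => k; apply/negligibleP => //.
  have [//|s Ss hs] := @sup_adherent _ S k.+1%:R^-1 _ Ssup.
  exact: mono (ltW hs) Ss.
- move=> e e0; rewrite lt_neqAle measure_ge0 andbT eq_sym; apply/eqP => h.
  have : (sup S + e <= sup S)%R by apply: ub_le_sup => //; case: Ssup.
  by rewrite gerDl leNgt e0.
Qed.

Lemma probability_of_measure (m : {measure set T -> \bar R}) (P0 : probability T R) :
  m [set: T] = 1 -> exists P : probability T R, forall A, P A = m A.
Proof.
move=> m1; exists (mnormalize m P0) => A.
by rewrite /= /mnormalize m1 onee_eq0 /= invr1 mule1.
Qed.

Lemma convex_comb_probability (P Q : probability T R) (t : R) : (0 <= t <= 1)%R ->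
  exists S : probability T R, (forall A, S A = (1 - t)%:E * P A + t%:E * Q A) /\
    forall h : T -> \bar R, measurable_fun setT h -> (forall x, 0 <= h x) ->
      \int[S]_x h x = (1 - t)%:E * \int[P]_x h x + t%:E * \int[Q]_x h x.
Proof.
move=> /andP[t0 t1]; have t1' : (0 <= 1 - t)%R by rewrite subr_ge0.
pose a := NngNum t1'; pose b := NngNum t0.
pose m : {measure set T -> \bar R} := measure_add (mscale a P) (mscale b Q).
have mE A : m A = (1 - t)%:E * P A + t%:E * Q A by exact: measure_addE.
have [|S SE] := @probability_of_measure m P.
  by rewrite mE !probability_setT !mule1 -EFinD subrK.
exists S; split => [A|h mh h0]; first by rewrite SE mE.
rewrite (eq_measure_integral m); last by move=> A _ _; exact: SE.
by rewrite /m ge0_integral_measure_add// !ge0_integral_mscale.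
Qed.

Lemma finite_sum_measure (I : Type) (s : seq I) (M : I -> {measure set T -> \bar R}) :
  exists m : {measure set T -> \bar R}, (forall A, m A = \sum_(i <- s) M i A) /\
    forall h : T -> \bar R, measurable_fun setT h -> (forall x, 0 <= h x) ->
      \int[m]_x h x = \sum_(i <- s) \int[M i]_x h x.
Proof.
elim: s => [|i s [m [mE mI]]].
  exists mzero; split => [A|h mh h0]; rewrite big_nil//.
  exact: integral_measure_zero.
exists (measure_add (M i) m); split => [A|h mh h0]; rewrite big_cons.
  by rewrite -mE; exact: measure_addE.
by rewrite ge0_integral_measure_add// mI.
Qed.

(** The building block of competitors: with [phi x = (x, xs i)] it sends the mass spread over [B] to
    one atom, and with the identity it yields the first marginal. The restriction to [B] is
    integrated as the density [\1_B]. *)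
Lemma scaled_restr_pushforward (d' : measure_display) (U : measurableType d')
    (mu : {measure set T -> \bar R}) (B : set T) (b : R) (phi : T -> U) :
  measurable B -> (0 <= b)%R -> measurable_fun setT phi ->
  exists m : {measure set U -> \bar R}, (forall A, m A = b%:E * mu (phi @^-1` A `&` B)) /\
    forall h : U -> \bar R, measurable_fun setT h -> (forall x, 0 <= h x) ->
      \int[m]_x h x = b%:E * \int[mu]_(x in B) h (phi x).
Proof.
move=> mB b0 mphi.
pose m1 : {measure set T -> \bar R} := mrestr mu mB.
pose m2 : {measure set U -> \bar R} := pushforward m1 phi.
exists (mscale (NngNum b0) (m2 mphi)); split => [A|h mh h0] //.
rewrite ge0_integral_mscale// /m2 ge0_integral_pushforward// preimage_setT /=.
congr (_ * _).
have mhphi : measurable_fun setT (h \o phi) by exact: measurableT_comp.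
rewrite (@ge0_integral_density mu m1 \1_B)//.
- rewrite [RHS]integral_mkcond; apply: eq_integral => x _.
  by rewrite epatch_indic.
- by move=> A mA; rewrite integral_indic// /m1 /= /mrestr setIC.
Qed.

Lemma limn_einf_le (a r : nat -> \bar R) (l : \bar R) :
  (forall n, a n <= r n) -> r @ \oo --> l -> limn_einf a <= l.
Proof.
move=> ar rl; rewrite -(cvg_limn_einf_sup rl).1 !limn_einf_lim.
apply: lee_lim; [exact: is_cvg_einfs|exact: is_cvg_einfs|].
apply: nearW => n; apply: le_ereal_inf_tmp => _ [k /= nk <-].
by apply: le_trans (ar k); apply: ereal_inf_lbound; exists k.
Qed.

End measure_facts.

(** * Transport plans, energies of densities, and the atomic competitor *)

Section transport.
Context (R : realType) (n : nat).
Local Notation V := (n.-tuple R).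
Implicit Types (mu nu rho : probability V R) (lam : {measure set V -> \bar R}).
Local Open Scope ereal_scope.

Lemma plan_integral_fst mu nu (g : probability (V * V)%type R) (h : V -> \bar R) :
  is_plan mu nu g -> measurable_fun setT h -> (forall x, 0 <= h x) ->
  \int[g]_z h z.1 = \int[mu]_x h x.
Proof.
move=> plan mh h0.
rewrite (@eq_measure_integral _ _ _ _ (pushforward g fst) mu); last first.
  move=> A mA _; apply: esym; apply: etrans; last exact: (plan A mA).1.
  by rewrite /pushforward /=; congr (g _); apply/seteqP; split => z /= => [|[]].
by rewrite ge0_integral_pushforward.
Qed.

Lemma plan_integral_snd mu nu (g : probability (V * V)%type R) (h : V -> \bar R) :
  is_plan mu nu g -> measurable_fun setT h -> (forall x, 0 <= h x) ->
  \int[g]_z h z.2 = \int[nu]_x h x.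
Proof.
move=> plan mh h0.
rewrite (@eq_measure_integral _ _ _ _ (pushforward g snd) nu); last first.
  move=> A mA _; apply: esym; apply: etrans; last exact: (plan A mA).2.
  by rewrite /pushforward /=; congr (g _); apply/seteqP; split => z /= => [|[]].
by rewrite ge0_integral_pushforward.
Qed.

Lemma Tcost_ge0 (p : R) mu nu : 0 <= Tcost p mu nu.
Proof.
apply: le_ereal_inf_tmp => _ [g _ <-]; apply: integral_ge0 => z _.
by rewrite lee_fin powR_ge0.
Qed.

Lemma density_integrable lam mu (u : V -> R) : is_density lam mu u ->
  lam.-integrable setT (EFin \o u).
Proof.
move=> [mu_ [u0 uE]]; apply/integrableP; split; first exact/measurable_EFinP.
under eq_integral do rewrite /= ger0_norm//.
by rewrite -uE// probability_setT ltry.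
Qed.

(** Two densities of [mu] have the same integral over every measurable set, so they agree almost
    everywhere and the infimum defining [Fen] ranges over a single value. *)
Lemma FenE lam (f : R -> R) (Omega : set V) mu (u : V -> R) :
  measurable Omega -> (forall t, (0 <= t)%R -> (0 <= f t)%R) ->
  {in `[0%R, +oo[ &, {homo f : x y / (x <= y)%R}} -> is_density lam mu u ->
  Fen lam f Omega mu = \int[lam]_(x in Omega) (f (u x))%:E.
Proof.
move=> mO f0 fnd du; apply/eqP; rewrite eq_le; apply/andP; split.
  by apply: ereal_inf_lbound; exists u.
have mf (v : V -> R) : is_density lam mu v ->
    measurable_fun Omega (fun x => (f (v x))%:E).
  move=> [mv [v0 _]]; apply: measurable_funTS; apply/measurable_EFinP.
  exact: measurable_ge0_nondecreasing.
apply: le_ereal_inf_tmp => _ [v dv <-].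
rewrite (@ge0_ae_eq_integral _ _ _ lam Omega _ (fun x => (f (v x))%:E))//.
- exact: mf.
- exact: mf.
- by move=> x _; rewrite lee_fin f0//; case: du => _ [].
- by move=> x _; rewrite lee_fin f0//; case: dv => _ [].
have : ae_eq lam setT (EFin \o u) (EFin \o v).
  apply: integral_ae_eq => //.
  - exact: density_integrable du.
  - by apply/measurable_EFinP; case: dv.
  - by move=> E _ mE; case: du => _ [_ <-] //; case: dv => _ [_ <-].
by apply: filterS => x /(_ I) /= [->].
Qed.

(** [mu] gives no mass to the complement of [Omega], so [h] may be cut off there before the density
    formula is applied. *)
Lemma density_integral lam (Omega : set V) mu (u : V -> R) (h : V -> \bar R) :
  measurable Omega -> Prob Omega mu -> is_density lam mu u ->
  measurable_fun setT h -> (forall x, 0 <= h x) ->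
  \int[mu]_x h x = \int[lam]_(x in Omega) (h x * (u x)%:E).
Proof.
move=> mO muO [mu_ [u0 uE]] mh h0.
have mOC : measurable (~` Omega) by exact: measurableC.
rewrite (@ge0_negligible_integral _ _ _ mu setT (~` Omega))// setTD setCK.
rewrite integral_mkcond (@ge0_integral_density _ _ _ lam mu u)//.
- rewrite [RHS]integral_mkcond; apply: eq_integral => x _.
  by rewrite !patchE; case: ifPn; rewrite ?mul0e.
- by apply/(measurable_restrictT _ mO); exact: measurable_funTS.
- by move=> x; rewrite erestrict_ge0.
Qed.

Section competitor.
Variables (m : nat) (a : 'I_m -> R) (xs : 'I_m -> V) (nu : probability V R).
Hypothesis nuE : forall A, measurable A ->
  nu A = (\sum_(i < m) (a i * (\1_A (xs i) : R)))%:E.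
Variables (lam : {measure set V -> \bar R}) (B : 'I_m -> set V) (b : 'I_m -> R).
Hypothesis mB : forall i, measurable (B i).
Hypothesis b0 : forall i, (0 <= b i)%R.
Hypothesis bB : forall i, (b i)%:E * lam (B i) = (a i)%:E.

(** Each piece spreads the mass [a i] uniformly over [B i] and transports it to [xs i]: [rho] is the
    sum of the restrictions of [b i * lam] to [B i], and [g] is the sum of their images under
    [x -> (x, xs i)]. *)
Lemma atomic_competitor : exists (rho : probability V R) (g : probability (V * V)%type R),
  [/\ is_plan rho nu g,
      is_density lam rho (fun x => \sum_(i < m) b i * \1_(B i) x)%R &
      forall h : V * V -> \bar R, measurable_fun setT h -> (forall z, 0 <= h z) ->
        \int[g]_z h z = \sum_(i < m) (b i)%:E * \int[lam]_(x in B i) h (x, xs i)].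
Proof.
have mphi i : measurable_fun [set: V] (fun x : V => (x, xs i)).
  by apply: measurable_fun_pair => //; exact: measurable_cst.
have [M hM] := fin_all_exists (fun i => scaled_restr_pushforward lam (mB i) (b0 i) (mphi i)).
have [M' hM'] := fin_all_exists (fun i =>
  scaled_restr_pushforward lam (mB i) (b0 i) (@measurable_id _ V setT)).
have [G [GE GI]] := finite_sum_measure (index_enum 'I_m) M.
have [P [PE PI]] := finite_sum_measure (index_enum 'I_m) M'.
have sa : \sum_(i < m) (a i)%:E = 1.
  rewrite sumEFin -(@probability_setT _ _ _ nu) nuE//; congr (_%:E).
  by apply: eq_bigr => i _; rewrite indicT mulr1.
have [|rho rhoE] := @probability_of_measure _ _ _ P nu.
  rewrite PE -sa; apply: eq_bigr => i _; have [-> _] := hM' i.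
  by rewrite preimage_setT setTI bB.
have [|g gE] := @probability_of_measure _ _ _ G (dirac (point, point)).
  rewrite GE -sa; apply: eq_bigr => i _; have [-> _] := hM i.
  by rewrite preimage_setT setTI bB.
exists rho, g; split.
- move=> A mA; rewrite gE rhoE nuE// !GE PE; split.
    apply: eq_bigr => i _; have [-> _] := hM i; have [-> _] := hM' i.
    by congr (_ * lam (_ `&` _)); apply/seteqP; split => x //= [].
  (* For the second marginal, the preimage of [setT * A] under [x -> (x, xs i)] is everything when
     [A] contains [xs i] and empty otherwise, so the piece contributes [a i] or 0. *)
  rewrite gE GE -sumEFin; apply: eq_bigr => i _; have [-> _] := hM i.
  rewrite indicE; case: (boolP (xs i \in A)) => xA; rewrite ?mulr1 ?mulr0.
    rewrite (_ : _ @^-1` _ = setT) ?setTI ?bB//.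
    by apply/seteqP; split => x //= _; split => //; exact/set_mem.
  rewrite (_ : _ @^-1` _ = set0) ?set0I ?measure0 ?mule0//.
  by rewrite -subset0 => x /= [_ /mem_set]; rewrite (negbTE xA).
- split; [|split].
  + by apply: measurable_sum => i; apply: measurable_funM => //; exact: measurable_indic.
  + by move=> x; apply: sumr_ge0 => i _; rewrite mulr_ge0.
  + move=> A mA; rewrite rhoE PE.
    under eq_integral do rewrite -sumEFin.
    rewrite ge0_integral_sum//.
    * apply: eq_bigr => i _; have [-> _] := hM' i.
      under eq_integral do rewrite EFinM.
      rewrite ge0_integralZl_EFin ?integral_indic//; last first.
        by apply/measurable_EFinP; exact: measurable_indic.
      by rewrite preimage_id setIC.
    * move=> i; apply/measurable_EFinP; apply: measurable_funM.
        exact: measurable_cst.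
      exact: measurable_indic.
    * by move=> i x _; rewrite lee_fin mulr_ge0.
- move=> h mh h0; rewrite (eq_measure_integral G); last by move=> A _ _; exact: gE.
  by rewrite GI//; apply: eq_bigr => i _; have [_ ->] := hM i.
Qed.

End competitor.

End transport.

(** * First variation of the energy along a mixture with a competitor *)

Section first_variation.
Context (R : realType) (n : nat).
Local Notation V := (n.-tuple R).
Variables (lam : {measure set V -> \bar R}) (Omega : set V) (p : R) (f df : R -> R).
Variables (nu mu : probability V R) (u : V -> R).
Hypothesis mO : measurable Omega.
Hypothesis f_ge0 : forall t : R, 0 <= t -> 0 <= f t.
Hypothesis fconvex : forall x y l : R, 0 <= x -> 0 <= y -> x != y -> 0 < l < 1 ->
     f (l * x + (1 - l) * y) < l * f x + (1 - l) * f y.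
Hypothesis fdf : forall t : R, 0 < t -> is_derive t 1 f (df t).
Hypothesis f0 : f 0 = 0.
Hypothesis df0 : df 0 = 0.
Hypothesis muO : Prob Omega mu.
Hypothesis du : is_density lam mu u.
Hypothesis mumin : forall rho, Prob Omega rho ->
  (Ffrak lam f Omega p nu mu <= Ffrak lam f Omega p nu rho)%E.

Let u0 : forall x, 0 <= u x. Proof. by case: du => _ []. Qed.
Let mu_ : measurable_fun setT u. Proof. by case: du. Qed.

Let f_nd : {in `[0, +oo[ &, {homo f : x y / x <= y}}.
Proof.
move=> x y; rewrite in_itv /= andbT => x0 _ xy.
exact: (convex_nondecreasing f_ge0 fconvex fdf f0 df0).
Qed.

Let df_nd : {in `[0, +oo[ &, {homo df : x y / x <= y}}.
Proof.
move=> x y; rewrite in_itv /= andbT => x0 _ xy.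
exact: (df_nondecreasing f_ge0 fconvex fdf f0 df0).
Qed.

Let df_ge0' (t : R) : 0 <= t -> 0 <= df t.
Proof. exact: (df_ge0 f_ge0 fconvex fdf f0 df0). Qed.

Lemma measurable_df_comp (v : V -> R) : measurable_fun setT v -> (forall x, 0 <= v x) ->
  measurable_fun setT (fun x => df (v x)).
Proof. exact: measurable_ge0_nondecreasing. Qed.

Variables (rho : probability V R) (g : probability (V * V)%type R) (w : V -> R).
Hypothesis rhoO : Prob Omega rho.
Hypothesis plang : is_plan rho nu g.
Hypothesis dw : is_density lam rho w.
Local Open Scope ereal_scope.
Hypothesis Kfin : \int[g]_z (powR (eudist z.1 z.2) p)%:E < +oo.
Hypothesis Fwfin : \int[lam]_(x in Omega) (f (w x))%:E < +oo.

Let w0 : forall x, (0 <= w x)%R. Proof. by case: dw => _ []. Qed.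
Let mw : measurable_fun setT w. Proof. by case: dw. Qed.

(** The competitor [rho] has finite energy, hence so does the minimizer; both terms of its energy
    are nonnegative, so each is finite. *)
Lemma minimal_energy_lty :
  Tcost p mu nu < +oo /\ \int[lam]_(x in Omega) (f (u x))%:E < +oo.
Proof.
have h : Ffrak lam f Omega p nu mu < +oo.
  apply: le_lt_trans (mumin rhoO) _; rewrite /Ffrak (FenE mO f_ge0 f_nd dw).
  by rewrite lte_add_pinfty//; apply: le_lt_trans Kfin; apply: ereal_inf_lbound; exists g.
move: h; rewrite /Ffrak (FenE mO f_ge0 f_nd du) => h.
split; apply: le_lt_trans h.
  by rewrite leeDl// integral_ge0// => x _; rewrite lee_fin f_ge0.
by rewrite leeDr// Tcost_ge0.
Qed.

Variable t : R.
Hypothesis t01 : (0 < t < 1)%R.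
Let v x := ((1 - t) * u x + t * w x)%R.

Let v0 x : (0 <= v x)%R.
Proof. have [t0 t1] := andP t01; have := u0 x; have := w0 x; rewrite /v; nra. Qed.

Let mv : measurable_fun setT v.
Proof. by apply: measurable_funD; apply: measurable_funM => //; exact: measurable_cst. Qed.

Let mf (x : V -> R) : measurable_fun setT x -> (forall y, (0 <= x y)%R) ->
  measurable_fun Omega (fun y => (f (x y))%:E).
Proof.
move=> mx x0; apply: measurable_funTS; apply/measurable_EFinP.
exact: measurable_ge0_nondecreasing.
Qed.

(** Pointwise convexity bounds [f (v x)] by the mixture of [f (u x)] and [f (w x)]. Finiteness is
    what later permits cancelling this integral. *)
Lemma interpolation_energy_lty : \int[lam]_(x in Omega) (f (v x))%:E < +oo.
Proof.
have [t0 t1] := andP t01.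
apply: (@le_lt_trans _ _ (\int[lam]_(x in Omega)
    ((1 - t)%:E * (f (u x))%:E + t%:E * (f (w x))%:E))).
  apply: ge0_le_integral => //; first by move=> x _; rewrite lee_fin f_ge0.
  - exact: mf.
  - by apply: emeasurable_funD; apply: emeasurable_funM => //;
      [exact: mf|exact: mf].
  - move=> x _; rewrite lee_fin /v.
    have -> : ((1 - t) * u x + t * w x = t * w x + (1 - t) * u x)%R by ring.
    have := convex_le fconvex (w0 x) (u0 x) t01; lra.
have t1' : (0 <= 1 - t)%R by lra.
have mfu := mf mu_ u0; have mfw := mf mw w0.
rewrite ge0_integralD//.
- rewrite !ge0_integralZl_EFin ?(ltW t0)//.
  + by rewrite lte_add_pinfty// lte_mul_pinfty// ?lee_fin ?(ltW t0)//; case: minimal_energy_lty.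
  + by move=> x _; rewrite lee_fin f_ge0.
  + by move=> x _; rewrite lee_fin f_ge0.
- by move=> x _; rewrite -EFinM lee_fin mulr_ge0// f_ge0.
- exact: emeasurable_funM.
- by move=> x _; rewrite -EFinM lee_fin mulr_ge0// ?f_ge0// ltW.
- exact: emeasurable_funM.
Qed.

(* Mixing a nearly optimal plan for [mu] with [g] gives a competitor for the mixture. *)
Lemma minimality_along_mixture :
  t%:E * Tcost p mu nu + \int[lam]_(x in Omega) (f (u x))%:E <=
  t%:E * \int[g]_z (powR (eudist z.1 z.2) p)%:E + \int[lam]_(x in Omega) (f (v x))%:E.
Proof.
have [t0 t1] := andP t01; have t1' : (0 <= 1 - t)%R by lra.
have t01' : (0 <= t <= 1)%R by rewrite !ltW.
have [Tfin Fufin] := minimal_energy_lty; have Fvfin := interpolation_energy_lty.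
have ge0F (x : V -> R) : (forall y, (0 <= x y)%R) ->
    0 <= \int[lam]_(y in Omega) (f (x y))%:E.
  by move=> x0; apply: integral_ge0 => y _; rewrite lee_fin f_ge0.
have ge0K (g' : probability (V * V)%type R) : 0 <= \int[g']_z (powR (eudist z.1 z.2) p)%:E.
  by apply: integral_ge0 => z _; rewrite lee_fin powR_ge0.
have mcost : measurable_fun setT (fun z : V * V => (powR (eudist z.1 z.2) p)%:E).
  by apply/measurable_EFinP; exact: measurable_eudist_powR.
have Tfn : Tcost p mu nu \is a fin_num by rewrite ge0_fin_numE// Tcost_ge0.
have Fufn := Fufin; rewrite -ge0_fin_numE in Fufn; last exact: ge0F.
have Fvfn := Fvfin; rewrite -ge0_fin_numE in Fvfn; last exact: ge0F.
have Kfn := Kfin; rewrite -ge0_fin_numE in Kfn; last exact: ge0K.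
have key (g' : probability (V * V)%type R) : is_plan mu nu g' ->
    Tcost p mu nu + \int[lam]_(x in Omega) (f (u x))%:E <=
    (1 - t)%:E * \int[g']_z (powR (eudist z.1 z.2) p)%:E +
    t%:E * \int[g]_z (powR (eudist z.1 z.2) p)%:E + \int[lam]_(x in Omega) (f (v x))%:E.
  move=> plang'.
  have [S [SE _]] := convex_comb_probability mu rho t01'.
  have [G [GE GI]] := convex_comb_probability g' g t01'.
  have dS : is_density lam S v.
    split; [exact: mv|split; [exact: v0|]] => A mA; rewrite SE /v.
    have [_ [_ uE]] := du; have [_ [_ wE]] := dw.
    rewrite uE// wE//.
    under [RHS]eq_integral do rewrite EFinD !EFinM.
    have mu' : measurable_fun A (fun x => (u x)%:E).
      by apply: measurable_funTS; apply/measurable_EFinP.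
    have mw' : measurable_fun A (fun x => (w x)%:E).
      by apply: measurable_funTS; apply/measurable_EFinP.
    rewrite ge0_integralD//.
    + by rewrite !ge0_integralZl_EFin ?(ltW t0)// => x _; rewrite lee_fin.
    + by move=> x _; rewrite -EFinM lee_fin mulr_ge0.
    + exact: emeasurable_funM.
    + by move=> x _; rewrite -EFinM lee_fin mulr_ge0// ltW.
    + exact: emeasurable_funM.
  have SO : Prob Omega S.
    by rewrite /Prob /= SE muO rhoO !mule0 adde0.
  have planG : is_plan S nu G.
    move=> A mA; rewrite !GE SE.
    have [-> ->] := plang' A mA; have [-> ->] := plang mA; split => //.
    have nuA : nu A \is a fin_num by exact: fin_num_measure.
    by rewrite -(fineK nuA) -!EFinM -EFinD; congr (_%:E); ring.
  rewrite -(GI _ mcost); last by move=> z; rewrite lee_fin powR_ge0.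
  have := mumin SO; rewrite /Ffrak (FenE mO f_ge0 f_nd du) (FenE mO f_ge0 f_nd dS).
  move=> h; apply: le_trans h _; rewrite leeD2r//.
  by apply: ereal_inf_lbound; exists G.
move: key; set K := \int[g]_z _; set Fu := \int[lam]_(x in _) _; set Fv := \int[lam]_(x in _) _.
move: Fufn Fvfn Kfn; rewrite -/K -/Fu -/Fv => Fufn Fvfn Kfn.
rewrite -(fineK Fufn) -(fineK Fvfn) -(fineK Kfn) => key.
have Tadh := fun (e : R) (e0 : (0 < e)%R) => lb_ereal_inf_adherent e0 Tfn.
move: key Tadh; rewrite -/(Tcost p mu nu) -(fineK Tfn) => key Tadh.
(* Write [T] for the transport cost. A plan [g'] of cost below [T + e] turns [key] into
   [T + Fu <= (1 - t) * (T + e) + t * K + Fv]; cancelling [(1 - t) * T] leaves the claim with an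
   error below [e]. *)
rewrite -!EFinM -!EFinD lee_fin; apply/ler_addgt0Pr => e e0.
have [_ [g' plang' <-]] := Tadh e e0.
move: (key g' plang').
have gfin : \int[g']_z (powR (eudist z.1 z.2) p)%:E < +oo -> 
   \int[g']_z (powR (eudist z.1 z.2) p)%:E \is a fin_num by rewrite ge0_fin_numE.
move=> h1 h2; have := gfin (lt_trans h2 (ltry _)); move: h1 h2.
set C := \int[g']_z _ => h1 h2 Cfn; move: h1 h2; rewrite -(fineK Cfn).
rewrite -!EFinM -!EFinD lee_fin lte_fin; nra.
Qed.

(** The tangent inequality at [v x], where [u x - v x = t * (u x - w x)], is integrated and added to
    [minimality_along_mixture]; the energies cancel and [t] is divided out. The two terms in
    [df (v x)] stay on opposite sides so that every integrand is nonnegative. *)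
Lemma variation_inequality :
  Tcost p mu nu + \int[lam]_(x in Omega) (df (v x) * u x)%:E <=
  \int[g]_z (powR (eudist z.1 z.2) p)%:E + \int[lam]_(x in Omega) (df (v x) * w x)%:E.
Proof.
have [t0 t1] := andP t01.
have [Tfin Fufin] := minimal_energy_lty; have Fvfin := interpolation_energy_lty.
have mdf (y : V -> R) : measurable_fun setT y ->
    measurable_fun Omega (fun x => (df (v x) * y x)%:E).
  move=> my; apply: measurable_funTS; apply/measurable_EFinP; apply: measurable_funM => //.
  exact: measurable_df_comp.
have mdfu := mdf _ mu_; have mdfw := mdf _ mw.
have ge0F (x : V -> R) : (forall y, (0 <= x y)%R) ->
    0 <= \int[lam]_(y in Omega) (f (x y))%:E.
  by move=> x0; apply: integral_ge0 => y _; rewrite lee_fin f_ge0.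
have ge0K : 0 <= \int[g]_z (powR (eudist z.1 z.2) p)%:E.
  by apply: integral_ge0 => z _; rewrite lee_fin powR_ge0.
have ge0D (y : V -> R) : (forall x, (0 <= y x)%R) ->
    0 <= \int[lam]_(x in Omega) (df (v x) * y x)%:E.
  by move=> y0; apply: integral_ge0 => x _; rewrite lee_fin mulr_ge0// df_ge0'.
have tangent : \int[lam]_(x in Omega) (f (v x))%:E +
      t%:E * \int[lam]_(x in Omega) (df (v x) * u x)%:E <=
    \int[lam]_(x in Omega) (f (u x))%:E + t%:E * \int[lam]_(x in Omega) (df (v x) * w x)%:E.
  have g0 (y : V -> R) : (forall x, (0 <= y x)%R) ->
      forall x, Omega x -> 0 <= (df (v x) * y x)%:E.
    by move=> y0 x _; rewrite lee_fin mulr_ge0// df_ge0'.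
  rewrite -!ge0_integralZl_EFin ?(ltW t0)//; [|exact: g0|exact: g0].
  rewrite -!ge0_integralD//; first last.
  - exact: emeasurable_funM.
  - by move=> x Ox; rewrite mule_ge0 ?lee_fin ?(ltW t0)// -lee_fin g0.
  - exact: mf.
  - by move=> x _; rewrite lee_fin f_ge0.
  - exact: emeasurable_funM.
  - by move=> x Ox; rewrite mule_ge0 ?lee_fin ?(ltW t0)// -lee_fin g0.
  - exact: mf.
  - by move=> x _; rewrite lee_fin f_ge0.
  apply: ge0_le_integral => //.
  - move=> x Ox; rewrite adde_ge0// ?lee_fin ?f_ge0//.
    by rewrite mulr_ge0 ?(ltW t0)// mulr_ge0// df_ge0'.
  - by apply: emeasurable_funD; [exact: mf|exact: emeasurable_funM].
  - by apply: emeasurable_funD; [exact: mf|exact: emeasurable_funM].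
  - move=> x Ox; rewrite -!EFinM -!EFinD lee_fin.
    have := tangent_le f_ge0 fconvex fdf f0 df0 (u0 x) (v0 x).
    have -> : (u x - v x = t * (u x - w x))%R by rewrite /v; ring.
    lra.
have := minimality_along_mixture; move: tangent.
have Tfn : Tcost p mu nu \is a fin_num by rewrite ge0_fin_numE// Tcost_ge0.
have Fufn := Fufin; rewrite -ge0_fin_numE in Fufn; last exact: ge0F.
have Fvfn := Fvfin; rewrite -ge0_fin_numE in Fvfn; last exact: ge0F.
have Kfn := Kfin; rewrite -ge0_fin_numE in Kfn; last exact: ge0K.
have := ge0D _ u0; have := ge0D _ w0.
rewrite -(fineK Tfn) -(fineK Fufn) -(fineK Fvfn) -(fineK Kfn).
move: (fine _) (fine _) (fine _) (fine (Tcost p mu nu)) => Fur Fvr Kr Tr.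
(* If the integral with [w] is infinite the claim is trivial; if it is finite, an infinite integral
   with [u] would contradict [tangent]. *)
case: (\int[lam]_(x in Omega) (df (v x) * w x)%:E) => [W| |]// _.
- case: (\int[lam]_(x in Omega) (df (v x) * u x)%:E) => [U| |]// _.
  + rewrite -!EFinM -!EFinD !lee_fin; nra.
  + by rewrite gt0_muley ?lte_fin// addey// -EFinM -EFinD leye_eq.
- by move=> _ _ _; rewrite addey// leey.
Qed.

End first_variation.

(** * Upper bound: mixing [mu] with mass placed on the almost minimal sets *)

Section optimality_upper.
Context (R : realType) (n : nat).
Local Notation V := (n.-tuple R).
Variables (lam : {measure set V -> \bar R}) (Omega : set V) (p : R) (f df k : R -> R).
Variables (m : nat) (a : 'I_m -> R) (xs : 'I_m -> V).
Variables (nu mu : probability V R) (u : V -> R).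
Hypothesis mO : measurable Omega.
Hypothesis lamO : (lam Omega < +oo)%E.
Hypothesis f_ge0 : forall t : R, 0 <= t -> 0 <= f t.
Hypothesis fconvex : forall x y l : R, 0 <= x -> 0 <= y -> x != y -> 0 < l < 1 ->
     f (l * x + (1 - l) * y) < l * f x + (1 - l) * f y.
Hypothesis fdf : forall t : R, 0 < t -> is_derive t 1 f (df t).
Hypothesis cdf : {within [set t : R | 0 <= t], continuous df}.
Hypothesis f0 : f 0 = 0.
Hypothesis df0 : df 0 = 0.
Hypothesis kK : forall s : R, 0 <= s -> 0 <= k s /\ df (k s) = s.
Hypothesis a_gt0 : forall i, 0 < a i.
Hypothesis nuE : forall A, measurable A ->
  nu A = (\sum_(i < m) (a i * (\1_A (xs i) : R)))%:E.
Hypothesis muO : Prob Omega mu.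
Hypothesis du : is_density lam mu u.
Hypothesis mumin : forall rho, Prob Omega rho ->
  (Ffrak lam f Omega p nu mu <= Ffrak lam f Omega p nu rho)%E.

Let u0 : forall x, 0 <= u x. Proof. by case: du => _ []. Qed.
Let mu_ : measurable_fun setT u. Proof. by case: du. Qed.
Let dfge0 (t : R) : 0 <= t -> 0 <= df t.
Proof. exact: (df_ge0 f_ge0 fconvex fdf f0 df0). Qed.
Let dfnd (s t : R) : 0 <= s -> s <= t -> df s <= df t.
Proof. exact: (df_nondecreasing f_ge0 fconvex fdf f0 df0). Qed.
Let mdf (v : V -> R) : measurable_fun setT v -> (forall x, 0 <= v x) ->
  measurable_fun setT (fun x => df (v x)).
Proof. exact: (measurable_df_comp f_ge0 fconvex fdf f0 df0). Qed.

Lemma df_cvg (s : nat -> R) (l : R) : (forall N, 0 <= s N) -> 0 <= l ->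
  s @ \oo --> l -> (df \o s) @ \oo --> df l.
Proof.
move=> s0 l0 sl; have /subspace_continuousP/(_ l l0) h := cdf.
apply: cvg_trans h => A /= hA.
have : \forall N \near \oo, (0 <= s N -> A (df (s N))) by exact: (sl _ hA).
by apply: filterS => N; exact.
Qed.

Variables (c : 'I_m -> R).
Hypothesis c_ge0 : forall i, 0 <= c i.
Hypothesis c_inf : forall i (e : R), 0 < e ->
  (0 < lam (Omega `&` [set x | df (u x) + powR (eudist x (xs i)) p < c i + e])%R)%E.

Local Open Scope ereal_scope.

Lemma optimality_upper_bound_eps (e : R) : (0 < e)%R ->
  Tcost p mu nu < +oo /\
  Tcost p mu nu + \int[lam]_(x in Omega) (df (u x) * u x)%:E <=
  (\sum_(i < m) a i * (c i + e))%:E.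
Proof.
move=> e0.
pose gg i x := (df (u x) + powR (eudist x (xs i)) p)%R.
have mgg i : measurable_fun setT (gg i).
  by apply: measurable_funD; [exact: mdf|exact: measurable_eudist_powRl].
pose B i := Omega `&` [set x | (gg i x < c i + e)%R].
have BO i : B i `<=` Omega by exact: subIsetl.
have mB i : measurable (B i).
  apply: measurableI => //; have := mgg i measurableT _ (measurable_itv `]-oo, (c i + e)%R[).
  by rewrite setTI; congr measurable; apply/seteqP; split => x /=; rewrite in_itv.
have B0 i : 0 < lam (B i) by exact: c_inf.
have Bfin i : lam (B i) \is a fin_num.
  rewrite ge0_fin_numE//; apply: le_lt_trans lamO.
  by apply: le_measure; rewrite ?inE.
have fB0 i : (0 < fine (lam (B i)))%R by rewrite fine_gt0// B0 ltey_eq Bfin.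
(* With this height the uniform density on [B i] has mass [a i], as [atomic_competitor] asks. *)
pose b i := (a i / fine (lam (B i)))%R.
have b0 i : (0 <= b i)%R by rewrite divr_ge0// ltW.
have bB i : (b i)%:E * lam (B i) = (a i)%:E.
  by rewrite -(fineK (Bfin i)) -EFinM divfK// gt_eqF.
have [rho [g [plang dw gI]]] := atomic_competitor nuE mB b0 bB.
move: dw; set w := (fun x => _) => dw.
have w0 x : (0 <= w x)%R by case: dw => _ [].
have mw : measurable_fun setT w by case: dw.
have w_out x : (forall i, ~ B i x) -> w x = 0%R.
  by move=> hx; rewrite /w big1// => i _; rewrite indicE memNset ?mulr0//; exact: hx.
pose bs := (\sum_(i < m) b i)%R.
have bs0 : (0 <= bs)%R by exact: sumr_ge0.
have w_le x : (w x <= bs)%R.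
  by apply: ler_sum => i _; rewrite indicE; case: (_ \in _); rewrite ?mulr1 ?mulr0.
have rhoO : Prob Omega rho.
  rewrite /Prob /=; have [_ [_ ->]] := dw; last exact: measurableC.
  rewrite (eq_integral (cst 0)) ?integral0// => x; rewrite inE => nOx.
  by rewrite w_out// => i /BO.
have mcost : measurable_fun setT (fun z : V * V => (powR (eudist z.1 z.2) p)%:E).
  by apply/measurable_EFinP; exact: measurable_eudist_powR.
have mdfu1 : measurable_fun setT (fun z : V * V => (df (u z.1))%:E).
  by apply/measurable_EFinP; exact: (measurableT_comp (mdf mu_ u0) measurable_fst).
have cost0 (z : V * V) : 0 <= (powR (eudist z.1 z.2) p)%:E by rewrite lee_fin powR_ge0.
have dfu10 (z : V * V) : 0 <= (df (u z.1))%:E by rewrite lee_fin dfge0.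
set K := \int[g]_z (powR (eudist z.1 z.2) p)%:E.
have K0 : 0 <= K by exact: integral_ge0.
pose W := \int[lam]_(x in Omega) (df (u x) * w x)%:E.
have W0 : 0 <= W by apply: integral_ge0 => x _; rewrite lee_fin mulr_ge0// dfge0.
(* On [B i] the integrand [|x - xs i|^p + df (u x)] is below [c i + e], and the piece over [B i] has
   mass [a i]. *)
have KW : K + W <= (\sum_(i < m) a i * (c i + e))%:E.
  have -> : W = \int[g]_z (df (u z.1))%:E.
    rewrite (plan_integral_fst (h := fun x => (df (u x))%:E) plang)//; first last.
    - by move=> x; rewrite lee_fin dfge0.
    - by apply/measurable_EFinP; exact: mdf.
    rewrite (density_integral mO rhoO dw)//.
    - by apply/measurable_EFinP; exact: mdf.
    - by move=> x; rewrite lee_fin dfge0.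
  rewrite -ge0_integralD// gI; first last.
  - by move=> z; exact: adde_ge0.
  - exact: emeasurable_funD.
  rewrite -sumEFin; apply: lee_sum => i _.
  rewrite [leRHS]EFinM -(bB i) -muleA lee_wpmul2l ?lee_fin// muleC -integral_cst//.
  apply: ge0_le_integral => //.
  - by move=> x _ /=; rewrite adde_ge0// lee_fin ?powR_ge0// dfge0.
  - apply: measurable_funTS; apply: emeasurable_funD; apply/measurable_EFinP.
      exact: measurable_eudist_powRl.
    exact: mdf.
  - by move=> x [_ /= hx]; rewrite lee_fin addrC ltW.
have Kfin : K < +oo.
  by apply: le_lt_trans (ltry _); apply: le_trans KW; rewrite leeDl.
have Wfin : W < +oo.
  by apply: le_lt_trans (ltry _); apply: le_trans KW; rewrite leeDr.
have Fwfin : \int[lam]_(x in Omega) (f (w x))%:E < +oo.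
  apply: (@le_lt_trans _ _ (\int[lam]_(x in Omega) (cst (f bs)%:E x))).
    apply: ge0_le_integral => //.
    - by move=> x _; rewrite lee_fin f_ge0.
    - apply: measurable_funTS; apply/measurable_EFinP.
      apply: measurable_ge0_nondecreasing => // x y; rewrite in_itv/= andbT => x0 _ xy.
      exact: (convex_nondecreasing f_ge0 fconvex fdf f0 df0).
    - move=> x _; rewrite lee_fin.
      exact: (convex_nondecreasing f_ge0 fconvex fdf f0 df0).
  by rewrite integral_cst// lte_mul_pinfty// lee_fin f_ge0.
have [Tfin _] := minimal_energy_lty mO f_ge0 fconvex fdf f0 df0 du mumin rhoO plang dw Kfin Fwfin.
split => //; apply: le_trans KW.
(* [N + 2] rather than [N + 1] keeps the weight strictly below 1 at [N = 0]. *)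
pose t (N : nat) : R := (N.+2%:R^-1)%R.
have t01 N : (0 < t N < 1)%R.
  by rewrite /t invr_gt0 ltr0n /= invf_lt1 ?ltr0n// ltr1n.
pose v N x := ((1 - t N) * u x + t N * w x)%R.
have v0 N x : (0 <= v N x)%R.
  by have /andP[? ?] := t01 N; have := u0 x; have := w0 x; rewrite /v; nra.
have mv N : measurable_fun setT (v N).
  by apply: measurable_funD; apply: measurable_funM => //; exact: measurable_cst.
have vcvg x : v^~ x @ \oo --> u x.
  have tcvg : t @ \oo --> (0 : R)%R.
    have := @cvg_harmonic R; rewrite -(@cvg_shiftn 1) => h.
    apply: cvg_trans h; apply: near_eq_cvg; apply: nearW => N.
    by rewrite /t /harmonic /= addn1.
  rewrite [X in _ --> X](_ : u x = ((1 - 0) * u x + 0 * w x)%R); last by ring.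
  apply: cvgD; apply: cvgM; [apply: cvgB|..]; by [exact: tcvg|exact: cvg_cst].
have dfvcvg (y : V -> R) x : (fun N => (df (v N x) * y x)%:E) @ \oo --> (df (u x) * y x)%:E.
  apply: cvg_EFin; first exact: nearW.
  by apply: cvgM; [exact: df_cvg|exact: cvg_cst].
have mdfv (y : V -> R) N : measurable_fun setT y ->
    measurable_fun Omega (fun x => (df (v N x) * y x)%:E).
  by move=> my; apply: measurable_funTS; apply/measurable_EFinP;
    apply: measurable_funM => //; exact: mdf.
(* On [B i], [df (u x) < c i + e] gives [u x < k (c i + e)]; with [w x <= bs] this yields
   [v N x <= Sb]. Outside all [B i], [w] vanishes. Thus the constant [df Sb * bs] dominates, and it
   is integrable because [Omega] has finite volume. *)
pose Sb := (\sum_(i < m) k (c i + e) + bs)%R.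
have Wcvg : (fun N => \int[lam]_(x in Omega) (df (v N x) * w x)%:E) @ \oo --> W.
  have [] // := @dominated_convergence _ _ _ lam Omega mO
    (fun N x => (df (v N x) * w x)%:E) (fun x => (df (u x) * w x)%:E)
    (EFin \o cst (df Sb * bs)%R).
  - by move=> N; exact: mdfv.
  - apply: measurable_funTS; apply/measurable_EFinP; apply: measurable_funM => //.
    exact: mdf.
  - by apply: aeW => x _; exact: dfvcvg.
  - apply/integrableP; split; first by apply/measurable_EFinP; exact: measurable_cst.
    by rewrite /= integral_cst// lte_mul_pinfty.
  - apply: aeW => x N Ox; rewrite /= lee_fin ger0_norm ?mulr_ge0 ?dfge0//.
    have kc i : (0 <= k (c i + e))%R.
      by have [] := kK (addr_ge0 (c_ge0 i) (ltW e0)).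
    have Sb0 : (0 <= Sb)%R by rewrite addr_ge0// sumr_ge0.
    have [hx|/existsNP[i /contrapT Bix]] := pselect (forall i, ~ B i x).
      by rewrite w_out// mulr0 mulr_ge0// dfge0.
    apply: ler_pM; rewrite ?dfge0//; apply: dfnd => //.
    have ux : (u x < k (c i + e))%R.
      apply: (lt_inverse_derivative f_ge0 fconvex fdf f0 df0 kK) => //.
        by rewrite addr_ge0// ltW.
      by case: Bix => _ /=; apply: le_lt_trans; rewrite lerDl powR_ge0.
    have uS : (u x <= \sum_(i < m) k (c i + e))%R.
      by rewrite (bigD1 i)//= (le_trans (ltW ux))// lerDl sumr_ge0.
    have /andP[? ?] := t01 N; have := w_le x; have := w0 x; have := u0 x.
    rewrite /v /Sb; nra.
have var N := variation_inequality mO f_ge0 fconvex fdf f0 df0 muO du mumin rhoO plang dw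
  Kfin Fwfin (t01 N).
have Tfn : Tcost p mu nu \is a fin_num by rewrite ge0_fin_numE// Tcost_ge0.
have Kfn : K \is a fin_num by rewrite ge0_fin_numE.
(* Here [u] is not known to be bounded on [Omega], so Fatou's lemma replaces dominated convergence.
   The transport cost is finite and can be moved to the right of each inequality [var N]. *)
have fat : \int[lam]_(x in Omega) (df (u x) * u x)%:E <= (K - Tcost p mu nu) + W.
  apply: le_trans (_ : limn_einf (fun N => \int[lam]_(x in Omega) (df (v N x) * u x)%:E) <= _).
    rewrite [leLHS](_ : _ = \int[lam]_(x in Omega)
        limn_einf (fun N => (df (v N x) * u x)%:E)); last first.
      by apply: eq_integral => x _; rewrite (cvg_limn_einf_sup (dfvcvg u x)).1.
    apply: fatou => // [N|N x _]; first exact: mdfv.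
    by rewrite lee_fin mulr_ge0// dfge0.
  apply: (@limn_einf_le _ _ (fun N => (K - Tcost p mu nu) +
     \int[lam]_(x in Omega) (df (v N x) * w x)%:E)).
    move=> N; rewrite addeAC leeBrDr// [leLHS]addeC; exact: var.
  apply: cvgeD => //; last exact: cvg_cst.
  by rewrite fin_num_adde_defr// fin_numB Kfn Tfn.
by move: fat; rewrite addeAC leeBrDr// [leLHS]addeC.
Qed.

End optimality_upper.

(** [c - r^p > 0] forces [c > 0] because [r^p >= 0]; strict monotonicity of the powers [p^-1] and
    [p] gives the two directions. This turns positivity of the envelope into membership in a
    ball. *)
Lemma subr_powR_gt0 (R : realType) (p c r : R) : 1 <= p -> 0 <= r ->
  0 < c - powR r p <-> 0 < c /\ r < powR c p^-1.
Proof.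
move=> p1 r0; have p0 : 0 < p by lra.
have pV : (p * p^-1 = 1)%R by rewrite divff// gt_eqF.
rewrite subr_gt0; split => [h|[c0 h]].
  have c0 : 0 < c by apply: le_lt_trans h; exact: powR_ge0.
  split => //; rewrite -[ltLHS]powRr1// -[X in powR _ X]pV powRrM.
  by apply: gt0_ltr_powR; rewrite ?invr_gt0// nnegrE ?powR_ge0// ltW.
have := @gt0_ltr_powR R p p0 _ _ _ _ h; rewrite !nnegrE r0 powR_ge0 => /(_ isT isT).
by rewrite -powRrM mulrC pV powRr1// ltW.
Qed.

(** * Transfer of almost-everywhere statements between measures, densities and plans *)

Section almost_everywhere.
Context (R : realType) (n : nat).
Local Notation V := (n.-tuple R).
Local Open Scope ereal_scope.

(** [u] integrates to 0 over a [lam]-null set, so such a set is also [mu]-null. *)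
Lemma density_ae (lam : {measure set V -> \bar R}) (mu : probability V R) (u : V -> R)
    (P : V -> Prop) : is_density lam mu u -> {ae lam, forall x, P x} -> {ae mu, forall x, P x}.
Proof.
move=> [mu_ [u0 uE]] [N [mN N0 PN]]; exists N; split => //.
have /= <- := integral_abs_eq0 mN (measurable_funTS ((measurable_EFinP _ _).2 mu_)) N0.
rewrite [LHS]uE//; apply: eq_integral => x _ /=.
by rewrite ger0_norm.
Qed.

(** A partial converse of [density_ae]: the nonnegative [u] has integral [mu N = 0] over [N], hence
    vanishes almost everywhere there. *)
Lemma density_null_ae (lam : {measure set V -> \bar R}) (mu : probability V R) (u : V -> R)
    (N : set V) : is_density lam mu u -> measurable N -> mu N = 0 ->
  {ae lam, forall x, N x -> u x = 0%R}.
Proof.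
move=> [mu_ [u0 uE]] mN N0.
have [+ _] := @ae_eq_integral_abs _ _ _ lam N mN (EFin \o u)
  (measurable_funTS ((measurable_EFinP _ _).2 mu_)).
rewrite (eq_integral (EFin \o u)); last by move=> x _; rewrite /= ger0_norm.
rewrite -uE// => /(_ N0); apply: filterS => x h Nx.
by have [] := h Nx.
Qed.

Lemma plan_ae_fst (mu nu : probability V R) (g : probability (V * V)%type R) (P : V -> Prop) :
  is_plan mu nu g -> {ae mu, forall x, P x} -> {ae g, forall z, P z.1}.
Proof.
move=> plan [N [mN N0 PN]]; exists (N `*` setT); split.
- exact: measurableX.
- by rewrite -N0; exact: (plan N mN).1.
- by move=> z /= nP; split => //; apply: PN.
Qed.

Lemma plan_ae_snd (mu nu : probability V R) (g : probability (V * V)%type R) (P : V -> Prop) :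
  is_plan mu nu g -> {ae nu, forall x, P x} -> {ae g, forall z, P z.2}.
Proof.
move=> plan [N [mN N0 PN]]; exists (setT `*` N); split.
- exact: measurableX.
- by rewrite -N0; exact: (plan N mN).2.
- by move=> z /= nP; split => //; apply: PN.
Qed.

End almost_everywhere.

(** * Integration against the atomic measure *)

Section atomic.
Context (R : realType) (n : nat).
Local Notation V := (n.-tuple R).
Variables (m : nat) (a : 'I_m -> R) (xs : 'I_m -> V) (nu : probability V R) (C : V -> R).
Hypothesis nuE : forall A, measurable A ->
  nu A = (\sum_(i < m) (a i * (\1_A (xs i) : R)))%:E.
Hypothesis C_ge0 : forall y, 0 <= C y.

(* The atoms may be repeated, hence [undup]. *)
Definition atom_potential (y : V) : R :=
  \sum_(z <- undup (codom xs)) C z * \1_[set z] y.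

Lemma atom_potential_atom i : atom_potential (xs i) = C (xs i).
Proof.
rewrite /atom_potential (bigD1_seq (xs i)) ?undup_uniq ?mem_undup ?codom_f//=.
rewrite indicE mem_set// mulr1 big1 ?addr0// => z zi.
by rewrite indicE memNset ?mulr0//= => /esym/eqP; rewrite (negbTE zi).
Qed.

Lemma atom_potential_ge0 y : 0 <= atom_potential y.
Proof. by apply: sumr_ge0 => z _; rewrite mulr_ge0. Qed.

Lemma measurable_atom_potential : measurable_fun setT atom_potential.
Proof.
apply: measurable_sum => z; apply: measurable_funM; first exact: measurable_cst.
by apply: measurable_indic; exact: measurable_esing.
Qed.

(** Exchanging the finite sums over potential values and over atoms leaves [a i] times the potential
    at [xs i]. The potential is the dual variable on the side of [nu]. *)
Lemma integral_atom_potential :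
  (\int[nu]_y (atom_potential y)%:E)%E = (\sum_(i < m) a i * C (xs i))%:E.
Proof.
rewrite /atom_potential; under eq_integral do rewrite -sumEFin.
have mi z : measurable_fun [set: V] (\1_[set z] : V -> R).
  by apply: measurable_indic; exact: measurable_esing.
rewrite ge0_integral_sum//; last 2 first.
- by move=> z; apply/measurable_EFinP; apply: measurable_funM => //; exact: measurable_cst.
- by move=> z y _; rewrite lee_fin mulr_ge0.
transitivity (\sum_(z <- undup (codom xs)) (C z * \sum_(i < m) a i * \1_[set z] (xs i))%:E)%E.
  apply: eq_bigr => z _; under eq_integral do rewrite EFinM.
  rewrite ge0_integralZl_EFin//; last exact/measurable_EFinP.
  rewrite integral_indic//; last exact: measurable_esing.
  by rewrite setIT EFinM; congr (_ * _)%E; apply: nuE; exact: measurable_esing.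
rewrite sumEFin; congr (_%:E); under eq_bigr do rewrite mulr_sumr.
rewrite exchange_big /=; apply: eq_bigr => i _.
rewrite -(atom_potential_atom i) /atom_potential mulr_sumr.
by apply: eq_bigr => z _; rewrite mulrCA.
Qed.

Lemma atomic_ae : {ae nu, forall y, exists i, y = xs i}.
Proof.
have mN : measurable (\bigcup_i [set xs i]).
  apply: countable_bigcupT_measurable => [|i]; first exact: countableP.
  exact: measurable_esing.
exists (~` \bigcup_i [set xs i]); split; first exact: measurableC.
  rewrite [LHS]nuE; last exact: measurableC.
  rewrite big1// => i _; rewrite indicE memNset ?mulr0//= => h.
  by apply: h; exists i.
by move=> y /= h [i _ /= yi]; apply: h; exists i.
Qed.

End atomic.

Lemma measurable_bigmax (d : measure_display) (T : measurableType d) (R : realType)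
    (I : Type) (s : seq I) (F : I -> T -> R) :
  (forall i, measurable_fun setT (F i)) ->
  measurable_fun setT (fun x => \big[Num.max/0]_(i <- s) F i x).
Proof.
move=> mF; elim: s => [|i s IHs].
  by under eq_fun do rewrite big_nil; exact: measurable_cst.
by under eq_fun do rewrite big_cons; exact: measurable_maxr.
Qed.

(** * Lower bound by duality, and complementary slackness *)

Section optimality_conditions.
Context (R : realType) (n : nat).
Local Notation V := (n.-tuple R).
Variables (lam : {measure set V -> \bar R}) (Omega : set V) (p : R) (h : V -> R).
Variables (m : nat) (a : 'I_m -> R) (xs : 'I_m -> V).
Variables (nu mu : probability V R) (u : V -> R) (C : V -> R).
Hypothesis nuE : forall A, measurable A ->
  nu A = (\sum_(i < m) (a i * (\1_A (xs i) : R)))%:E.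
Hypothesis muO : Prob Omega mu.
Hypothesis mO : measurable Omega.
Hypothesis du : is_density lam mu u.
Hypothesis h_ge0 : forall x, 0 <= h x.
Hypothesis mh : measurable_fun setT h.
Hypothesis C_ge0 : forall y, 0 <= C y.
Hypothesis C_le : {ae lam, forall x, Omega x ->
  forall i, C (xs i) <= h x + powR (eudist x (xs i)) p}.
Local Open Scope ereal_scope.

Let M x := (\big[Num.max/0]_(i < m) (C (xs i) - powR (eudist x (xs i)) p))%R.
Let S := (\sum_(i < m) a i * C (xs i))%R.

Lemma measurable_upper_envelope : measurable_fun setT M.
Proof.
apply: measurable_bigmax => i; apply: measurable_funB; first exact: measurable_cst.
exact: measurable_eudist_powRl.
Qed.

(** Almost everywhere on [Omega] one has [h >= M], and this is the slack [h - M]; truncating at 0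
    makes it nonnegative everywhere, so that it can be integrated without integrability
    assumptions. *)
Let D x := Num.max 0%R (h x - M x)%R.

(** For [g]-almost every [z], [z.1] satisfies [C_le] and [z.2] is some [xs i]. There [C (xs i) + D
    z.1 <= h z.1 + |z.1 - xs i|^p]: by [C_le] if [D z.1 = 0], and by
    [C (xs i) - |z.1 - xs i|^p <= M z.1] otherwise. Integrating against [g] and reading off its
    marginals gives the bound. *)
Lemma dual_lower_bound (g : probability (V * V)%type R) : is_plan mu nu g ->
  S%:E + \int[mu]_x (D x)%:E <=
  \int[mu]_x (h x)%:E + \int[g]_z (powR (eudist z.1 z.2) p)%:E.
Proof.
move=> plan.
have mD : measurable_fun setT D.
  apply: measurable_maxr; first exact: measurable_cst.
  by apply: measurable_funB => //; exact: measurable_upper_envelope.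
have D0 x : (0 <= D x)%R by rewrite /D le_max lexx.
have mphi : measurable_fun setT (fun y => (atom_potential xs C y)%:E).
  by apply/measurable_EFinP; exact: measurable_atom_potential.
have phi0 y : 0 <= (atom_potential xs C y)%:E by rewrite lee_fin atom_potential_ge0.
have mcost : measurable_fun setT (fun z : V * V => (powR (eudist z.1 z.2) p)%:E).
  by apply/measurable_EFinP; exact: measurable_eudist_powR.
rewrite -(integral_atom_potential nuE C_ge0).
rewrite -(plan_integral_snd plan mphi phi0).
rewrite -(plan_integral_fst (h := fun x => (D x)%:E) plan)//; last exact/measurable_EFinP.
rewrite -(plan_integral_fst (h := fun x => (h x)%:E) plan)//; last exact/measurable_EFinP.
have mphi2 : measurable_fun setT (fun z : V * V => (atom_potential xs C z.2)%:E).
  exact: (measurableT_comp mphi measurable_snd).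
have mD1 : measurable_fun setT (fun z : V * V => (D z.1)%:E).
  by apply/measurable_EFinP; exact: (measurableT_comp mD measurable_fst).
have mh1 : measurable_fun setT (fun z : V * V => (h z.1)%:E).
  by apply/measurable_EFinP; exact: (measurableT_comp mh measurable_fst).
have D1 (z : V * V) : 0 <= (D z.1)%:E by rewrite lee_fin.
have h1 (z : V * V) : 0 <= (h z.1)%:E by rewrite lee_fin.
have cost0 (z : V * V) : 0 <= (powR (eudist z.1 z.2) p)%:E by rewrite lee_fin powR_ge0.
rewrite -!ge0_integralD//.
apply: ae_ge0_le_integral => //.
- by move=> z _; rewrite adde_ge0.
- exact: emeasurable_funD.
- by move=> z _; rewrite adde_ge0.
- exact: emeasurable_funD.
have aeO : {ae mu, forall x, Omega x}.
  by exists (~` Omega); split => //; exact: measurableC.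
have ae1 := plan_ae_fst plan aeO.
have ae2 := plan_ae_fst plan (density_ae du C_le).
have ae3 := plan_ae_snd plan (atomic_ae nuE).
apply: filterS3 ae1 ae2 ae3 => z Oz Cz [i zi] _.
rewrite zi atom_potential_atom -!EFinD lee_fin.
have hC := Cz Oz i.
have MC : (C (xs i) - powR (eudist z.1 (xs i)) p <= M z.1)%R.
  exact: (le_bigmax _ (fun i => C (xs i) - powR (eudist z.1 (xs i)) p)%R).
rewrite -lerBrDl /D ge_max; apply/andP; split; lra.
Qed.

(** Nearly optimal plans in [dual_lower_bound], together with the assumed upper bound, force the
    [mu]-integral of [D] to be 0. So [D = 0] off a [mu]-null set [N], and [u = 0] almost everywhere
    on [N]. Where [u > 0] this gives [h <= M]; the reverse is [C_le] with [h >= 0]. *)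
Lemma complementary_slackness :
  Tcost p mu nu < +oo ->
  Tcost p mu nu + \int[lam]_(x in Omega) (h x * u x)%:E <= S%:E ->
  {ae lam, forall x, Omega x -> (0 < u x)%R -> h x = M x}.
Proof.
move=> Tfin upper.
have mD : measurable_fun setT D.
  apply: measurable_maxr; first exact: measurable_cst.
  by apply: measurable_funB => //; exact: measurable_upper_envelope.
have D0 x : (0 <= D x)%R by rewrite /D le_max lexx.
have [u0 mu_] : (forall x, (0 <= u x)%R) /\ measurable_fun setT u by case: du => ? [].
have Tfn : Tcost p mu nu \is a fin_num by rewrite ge0_fin_numE// Tcost_ge0.
have hE : \int[mu]_x (h x)%:E = \int[lam]_(x in Omega) (h x * u x)%:E.
  by rewrite (density_integral mO muO du)//; apply/measurable_EFinP.
have U0 : 0 <= \int[mu]_x (h x)%:E by apply: integral_ge0 => x _; rewrite lee_fin.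
move: upper; rewrite -hE => upper.
have intD0 : \int[mu]_x (D x)%:E = 0.
  apply/eqP; rewrite eq_le integral_ge0 ?andbT; last by move=> x _; rewrite lee_fin.
  apply/lee_addgt0Pr => e e0; rewrite add0e.
  have [_ [g plan <-] cg] := lb_ereal_inf_adherent e0 Tfn.
  have lb := dual_lower_bound plan.
  rewrite -(@leeD2lE _ S%:E)//; apply: (le_trans lb).
  apply: (@le_trans _ _ (\int[mu]_x (h x)%:E + (Tcost p mu nu + e%:E))).
    by rewrite leeD2l// ltW.
  by rewrite addeCA addeA [leRHS]addeC [leLHS]addeC leeD2l.
have : ae_eq mu setT (fun x => (D x)%:E) (cst 0).
  apply/ae_eq_integral_abs => //; first exact/measurable_EFinP.
  by rewrite -intD0; apply: eq_integral => x _; rewrite gee0_abs// lee_fin.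
move=> [N [mN N0 DN]].
apply: filterS2 C_le (density_null_ae du mN N0) => x Cx Nx Ox ux.
have : ~ N x by move=> /Nx ux0; move: ux; rewrite ux0 ltxx.
move=> nNx; have /contrapT/(_ I) [Dx] := contra_not (DN x) nNx.
apply/le_anti/andP; split.
  by have : (h x - M x <= D x)%R; [rewrite /D le_max lexx orbT|rewrite Dx subr_le0].
apply: bigmax_le => // i _; have := Cx Ox i; lra.
Qed.

End optimality_conditions.

(** * Choice of the constants, formula for [u], and its positivity set *)

Theorem theorem4p2 (R : realType) (n : nat)
  (lam : {measure set (n.-tuple R) -> \bar R}) (Omega : set (n.-tuple R))
  (p : R) (f df k : R -> R)
  (m : nat) (a : 'I_m -> R) (xs : 'I_m -> n.-tuple R) (nu : probability (n.-tuple R) R)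
  (mu : probability (n.-tuple R) R) (u : n.-tuple R -> R) :
  is_lebesgue lam ->
  bounded_domain lam Omega ->
  1 <= p ->
  (* standing assumptions on f, with f' = df on [0, +oo) *)
  (forall t : R, 0 <= t -> 0 <= f t) ->
  (forall x y l : R, 0 <= x -> 0 <= y -> x != y -> 0 < l < 1 ->
     f (l * x + (1 - l) * y) < l * f x + (1 - l) * f y) ->
  (forall t : R, 0 < t -> is_derive t 1 f (df t)) ->
  (fun h : R => (f h - f 0) / h) @ 0^'+ --> df 0 ->
  {within [set t : R | 0 <= t], continuous df} ->
  f 0 = 0 ->
  df 0 = 0 ->
  (fun t : R => f t / t) @ +oo --> +oo ->
  (* k = (f')^{-1} : [0, +oo) -> [0, +oo) *)
  (forall t : R, 0 <= t -> k (df t) = t) ->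
  (forall s : R, 0 <= s -> 0 <= k s /\ df (k s) = s) ->
  (* nu = sum_i a_i delta_{x_i} in P(Omega) *)
  (forall i, 0 < a i) ->
  Prob Omega nu ->
  (forall A, measurable A -> nu A = (\sum_(i < m) (a i * (\1_A (xs i) : R)))%:E) ->
  (* mu = u . L^n minimizes frak F^p_nu over P(Omega) *)
  Prob Omega mu ->
  is_density lam mu u ->
  (forall rho, Prob Omega rho -> (Ffrak lam f Omega p nu mu <= Ffrak lam f Omega p nu rho)%E) ->
  exists c : 'I_m -> R,
    {ae lam, forall x, Omega x ->
       u x = k (\big[Num.max/0]_(i < m) (c i - powR (eudist x (xs i)) p))} /\
    {ae lam, forall x,
       0 < u x <-> Omega x /\ exists i : 'I_m, 0 < c i /\ eudist x (xs i) < powR (c i) (p^-1)}.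
Proof.
move=> hlam [Obd [[G [_ [_ [_ OE]]]] _]] p1 f_ge0 fconvex fdf _ cdf f0 df0 _ dfK kK a_gt0 _ nuE
  muO du mumin.
have mO : measurable Omega by rewrite OE; exact: measurable_eclosure.
have lamO : (lam Omega < +oo)%E by exact: ebounded_measure_lty.
have [u0 mu_] : (forall x, 0 <= u x) /\ measurable_fun setT u by case: du => ? [].
have dfge0 t : 0 <= t -> 0 <= df t by exact: (df_ge0 f_ge0 fconvex fdf f0 df0).
have mdfu : measurable_fun setT (fun x => df (u x)).
  exact: (measurable_df_comp f_ge0 fconvex fdf f0 df0).
(* A null [Omega] would also be [mu]-null, whereas [mu] is carried by [Omega]. Positive volume makes
   the essential infima finite. *)
have lamO0 : (0 < lam Omega)%E.
  rewrite lt_neqAle measure_ge0 andbT eq_sym; apply/eqP => O0.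
  have : {ae mu, forall x, ~ Omega x}.
    by apply: (density_ae du); exists Omega; split => // x /= /contrapT.
  move=> [N [mN N0 ON]].
  have := probability_setC mu mO; rewrite [LHS]muO.
  suff -> : mu Omega = 0%E by rewrite sube0 => /eqP; rewrite eq_sym onee_eq0.
  apply/eqP; rewrite eq_le measure_ge0 andbT -N0.
  by apply: le_measure; rewrite ?inE// => x Ox; apply: ON => /=; exact.
have gmeas y : measurable_fun setT (fun x => df (u x) + powR (eudist x y) p).
  by apply: measurable_funD => //; exact: measurable_eudist_powRl.
have g_ge0 y x : 0 <= df (u x) + powR (eudist x y) p.
  by rewrite addr_ge0 ?powR_ge0 ?dfge0.
(* The constant is chosen as a function of the point rather than of the index, so that repeated
   atoms share it, as [atom_potential] requires. *)
have [C hC] := choice (fun y => exists_ess_inf mO lamO0 (gmeas y) (g_ge0 y)).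
pose c i := C (xs i).
have sa : \sum_(i < m) a i = 1.
  have := probability_setT nu; rewrite nuE// => -[<-].
  by apply: eq_bigr => i _; rewrite indicT mulr1.
have C_ge0 y : 0 <= C y by have [] := hC y.
have upper (e : R) (e0 : 0 < e) := optimality_upper_bound_eps mO lamO f_ge0 fconvex fdf cdf
  f0 df0 kK a_gt0 nuE muO du mumin (fun i => C_ge0 (xs i))
  (fun i e e0 => let: And3 _ _ h := hC (xs i) in h e e0) e0.
have Tfin := (upper 1 ltr01).1.
have C_le : {ae lam, forall x, Omega x ->
    forall i, C (xs i) <= df (u x) + powR (eudist x (xs i)) p}.
  have Ci (i : 'I_m) : {ae lam, forall x, Omega x ->
      C (xs i) <= df (u x) + powR (eudist x (xs i)) p}.
    have [_ Ci0 _] := hC (xs i).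
    exists (Omega `&` [set x | df (u x) + powR (eudist x (xs i)) p < C (xs i)]); split => //.
      apply: measurableI => //.
      have := gmeas (xs i) measurableT _ (measurable_itv `]-oo, C (xs i)[).
      by rewrite setTI; congr measurable; apply/seteqP; split => x /=; rewrite in_itv.
    by move=> x /= /not_implyP[Ox /negP]; rewrite -ltNge.
  have {}Ci : {ae lam, forall x (i : 'I_m), Omega x ->
      C (xs i) <= df (u x) + powR (eudist x (xs i)) p} by exact: filter_forall.
  by apply: filterS Ci => x h Ox i; exact: h.
have slack : {ae lam, forall x, Omega x -> 0 < u x ->
    df (u x) = \big[Num.max/0]_(i < m) (c i - powR (eudist x (xs i)) p)}.
  apply: (complementary_slackness nuE muO mO du _ mdfu C_ge0 C_le Tfin).
    by move=> x; exact: dfge0.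
  (* The weights [a i] sum to 1, so the upper bound exceeds the sum of the [a i * c i] by exactly
     [e]. *)
  apply/lee_addgt0Pr => e e0; apply: le_trans (upper e e0).2 _.
  rewrite -EFinD lee_fin; under eq_bigr do rewrite mulrDr.
  by rewrite big_split /= -mulr_suml sa mul1r.
have uk : {ae lam, forall x, Omega x ->
    u x = k (\big[Num.max/0]_(i < m) (c i - powR (eudist x (xs i)) p))}.
  apply: filterS2 slack C_le => x sx Cx Ox.
  have [ux|] := ltP 0 (u x); first by rewrite -sx// dfK.
  move=> ux; have {ux}ux0 : u x = 0 by apply/le_anti; rewrite ux u0.
  (* Where [u x = 0], [C_le] reads [c i <= |x - xs i|^p] because [df 0 = 0]; the maximum is then 0,
     and [k 0 = 0]. *)
  rewrite ux0 (_ : \big[_/_]_(i < m) _ = 0) ?(inverse_derivative0 df0 dfK)//.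
  apply/le_anti; rewrite bigmax_le//=; last first.
    by move=> i _; have := Cx Ox i; rewrite ux0 df0 /c; lra.
  by elim/big_rec : _ => // i y _ y0; rewrite le_max y0 orbT.
exists c; split => //.
(* The formula for [u] concerns [Omega] only, while the second claim ranges over all [x]; outside
   [Omega], [mu] has no mass, so [u] vanishes almost everywhere. *)
have out : {ae lam, forall x, (~` Omega) x -> u x = 0}.
  by apply: (density_null_ae du) => //; exact: measurableC.
apply: filterS2 uk out => x ukx outx.
have M0 : 0 <= \big[Num.max/0]_(i < m) (c i - powR (eudist x (xs i)) p).
  by elim/big_rec : _ => // i y _ y0; rewrite le_max y0 orbT.
split.
  move=> ux; have Ox : Omega x by apply: contrapT => /outx ux0; rewrite ux0 ltxx in ux.
  split => //; move: ux; rewrite (ukx Ox) (inverse_derivative_gt0 df0 dfK kK)//.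
  move=> /bigmax_gtP[|[i _ ci]]; first by rewrite ltxx.
  by exists i; apply/(subr_powR_gt0 _ p1 (eudist_ge0 _ _)).
move=> [Ox [i ci]]; rewrite (ukx Ox) (inverse_derivative_gt0 df0 dfK kK)//.
apply/bigmax_gtP; right; exists i => //.
by apply/(subr_powR_gt0 _ p1 (eudist_ge0 _ _)).
Qed.
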